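(* Let $A \in \mathbb{R}^{n\times n}$ be a stable matrix, let $V = \{b_1,\dots,b_M\}$ be a set of possible input matrix columns $b_i\in\mathbb{R}^n$, and for $S \subseteq V$ let $W_S$ be the controllability Gramian associated with $S$. Then the set function $f : 2^V \to \mathbb{R}$ defined by $$f(S) = \operatorname{rank}(W_S)$$ is submodular.
   Context: A matrix $A$ is stable if all its eigenvalues have negative real part. A (possibly empty) existing input matrix $B_0$ with $n$ rows is fixed. For $S\subseteq V$, $B_S = [B_0 \;\; b_s]_{s\in S}$ is the matrix whose columns are those of $B_0$ together with the columns $b_s$ in $S$. The (infinite-horizon) controllability Gramian associated with $S$ is $$W_S = \int_0^\infty e^{A\tau} B_S B_S^T e^{A^T\tau}\,d\tau,$$ equivalently the unique positive semidefinite solution of the Lyapunov equation $A W_S + W_S A^T + B_S B_S^T = 0$ (with $W_S=0$ if $B_S$ has no columns). A set function $f : 2^V \to \mathbb{R}$ is submodular if for all subsets $X\subseteq Y\subseteq V$ and all $a\in V\setminus Y$, $$f(X\cup\{a\}) - f(X) \ge f(Y\cup\{a\}) - f(Y).$$ *)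

(* Defs.v *)
From HB Require Import structures.
From mathcomp Require Import all_boot all_order all_algebra.
From mathcomp Require Import all_classical all_reals all_analysis.
From mathcomp Require Import complex.

Set Implicit Arguments.
Unset Strict Implicit.
Unset Printing Implicit Defensive.

Import Order.TTheory GRing.Theory Num.Theory.
Import numFieldNormedType.Exports.

Local Open Scope classical_set_scope.
Local Open Scope ring_scope.

(* [eigenvalue] only sees eigenvalues in the base field, so the real matrix is
   first mapped to the complex numbers R[i]. *)
Definition stable (R : rcfType) (n : nat) (A : 'M[R]_n) : Prop :=
  forall l : R[i],
    eigenvalue (map_mx (real_complex R) A) l -> complex.Re l < 0.

Definition expmx (R : realType) (n : nat) (A : 'M[R]_n) : 'M[R]_n :=
  limn (series (fun k : nat => k`!%:R^-1 *: A ^+ k)).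

Section Gramian.
Variables (R : realType) (n p M : nat).
Variables (A : 'M[R]_n) (B0 : 'M[R]_(n, p)) (b : 'I_M -> 'cV[R]_n).

(* p = 0 is the case of no existing inputs. *)
Definition input_mx (S : {set 'I_M}) : 'M[R]_(n, p + #|S|) :=
  row_mx B0 (\matrix_(i < n, j < #|S|) b (enum_val j) i 0).

Definition gramian_integrand (S : {set 'I_M}) (t : R) : 'M[R]_n :=
  expmx (t *: A) *m input_mx S *m (input_mx S)^T *m expmx (t *: A^T).

(* The integral over [0, +oo) is the Lebesgue one, taken entry by entry. *)
Definition gramian (S : {set 'I_M}) : 'M[R]_n :=
  \matrix_(i < n, j < n)
    \int[@lebesgue_measure R]_(t in `[0, +oo[) gramian_integrand S t i j.

End Gramian.

Definition submodular (R : numDomainType) (T : finType) (f : {set T} -> R) :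
    Prop :=
  forall (X Y : {set T}) (a : T), X \subset Y -> a \notin Y ->
    f (a |: X) - f X >= f (a |: Y) - f Y.

(* Main.v *)
Require Import Defs.
From mathcomp Require Import all_boot all_order all_algebra.
From mathcomp Require Import all_classical all_reals all_analysis.
From mathcomp Require Import measurable_realfun.
From mathcomp Require Import complex spectral ring lra zify.

Import Order.TTheory GRing.Theory Num.Theory.
Import numFieldNormedType.Exports.
Local Open Scope classical_set_scope.
Local Open Scope ring_scope.

(** Only [B_S B_S^T] enters the Gramian, and it is the sum of [B0 B0^T] and of
    the [b_s b_s^T] with [s] in [S] ([input_mx_mulT]).  Since [A] is stable, the
    integral [Q |-> int_0^oo e^(tA) Q e^(tA)^T dt] converges for every [Q]; it
    is additive ([gram_integralD]) and maps positive semidefinite matrices to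
    positive semidefinite ones ([psd_gram_integral]).  So [W_S] is a sum of
    positive semidefinite matrices, one for [B0] and one for each [s] in [S].

    For positive semidefinite [P] and [Q], the kernel of [P + Q] is the
    intersection of the two kernels, so the row space of [P + Q] is the sum of
    the two row spaces ([psd_addsmx]).  Hence the rank of [W_S] is the dimension
    of a sum of fixed subspaces indexed by [S], and adding a subspace [G] to a
    larger space raises the dimension by no more, because the intersection with
    [G] can only grow ([psd_rank_submodular]).

    Convergence of the integral rests on the exponential decay of [e^(tA)], which
    is obtained by Lyapunov's method.  Over the complex numbers [A] is
    triangularizable; conjugating by a diagonal matrix of powers of a small
    [eps] makes the off-diagonal part negligible with respect to the real parts
    of the diagonal, which are negative ([trig_dissipative]).  The squared norm
    in the resulting basis, restricted to real vectors, is a quadratic form [H]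
    that decreases at an exponential rate along [x' = x A] and bounds the
    squares of the coordinates ([stable_lyapunov]).  Applied to the rows of
    [e^(tA)], whose entries are everywhere convergent power series, with
    derivative [e^(tA) A] ([is_derive_expmx]), this shows that the squares of
    the entries of [e^(tA)] are O(e^(-ct)) ([stable_expmx_decay]), so that the
    products of two entries are integrable on the half-line. *)

Set Implicit Arguments.
Unset Strict Implicit.

Local Notation Re := complex.Re.
Local Notation Im := complex.Im.

(** * Ranks of sums of positive semidefinite matrices *)

Definition psd (F : realFieldType) n (P : 'M[F]_n) :=
  P^T = P /\ forall u : 'rV_n, 0 <= (u *m P *m u^T) 0 0.

Lemma psdD (F : realFieldType) n (P Q : 'M[F]_n) :
  psd P -> psd Q -> psd (P + Q).
Proof.
move=> [sP pP] [sQ pQ]; split; first by rewrite linearD/= sP sQ.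
by move=> u; rewrite mulmxDr mulmxDl mxE addr_ge0.
Qed.

Lemma mulmx_trE (F : pzSemiRingType) n (u v : 'rV[F]_n) :
  (u *m v^T) 0 0 = \sum_i u 0 i * v 0 i.
Proof. by rewrite mxE; apply: eq_bigr => i _; rewrite mxE. Qed.

Lemma bilinearE (F : pzSemiRingType) n (H : 'M[F]_n) (x z : 'rV[F]_n) :
  (x *m H *m z^T) 0 0 = \sum_i \sum_j x 0 j * H j i * z 0 i.
Proof.
by rewrite mxE; apply: eq_bigr => i _; rewrite mxE [_^T _ _]mxE mulr_suml.
Qed.

Lemma psd_mulmxT (F : realFieldType) n m (B : 'M[F]_(n, m)) : psd (B *m B^T).
Proof.
split; first by rewrite trmx_mul trmxK.
move=> u; rewrite mulmxA -mulmxA -trmx_mul mulmx_trE.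
by apply: sumr_ge0 => i _; rewrite -expr2 sqr_ge0.
Qed.

Lemma mulmx_tr_eq0 (F : realFieldType) n (u : 'rV[F]_n) :
  (u *m u^T) 0 0 <= 0 -> u = 0.
Proof.
rewrite mulmx_trE => u0; have pos i : true -> 0 <= u 0 i * u 0 i.
  by rewrite -expr2 sqr_ge0.
have /eqP : \sum_i u 0 i * u 0 i == 0 by rewrite eq_le u0 sumr_ge0.
move/(psumr_eq0P pos) => h; apply/rowP => i.
by have /eqP := h i isT; rewrite mxE mulf_eq0 orbb => /eqP.
Qed.

(** The quadratic form vanishes at [u] and is nonnegative on the line through
    [u] directed by [w = u P]; its first-order term along that line is
    [2 t |w|^2], which therefore has to be zero. *)
Lemma psd_isotropic (F : realFieldType) n (P : 'M[F]_n) (u : 'rV_n) :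
  psd P -> (u *m P *m u^T) 0 0 = 0 -> u *m P = 0.
Proof.
move=> [sP pP] u0; pose w := u *m P.
pose a : F := (w *m w^T) 0 0; pose b : F := (w *m P *m w^T) 0 0.
have b0 : 0 <= b by exact: pP.
have wu : (w *m P *m u^T) 0 0 = a.
  have wT : w^T = P *m u^T by rewrite /w trmx_mul sP.
  by rewrite /a wT mulmxA.
have addE (X Y : 'M[F]_1) : (X + Y) 0 0 = X 0 0 + Y 0 0 by rewrite mxE.
have scaleE c (X : 'M[F]_1) : (c *: X) 0 0 = c * X 0 0 by rewrite mxE.
have key t : 0 <= 2 * t * a + t ^+ 2 * b.
  have := pP (u + t *: w).
  rewrite linearD/= linearZ/= !mulmxDl !mulmxDr -!scalemxAl -!scalemxAr scalerA.
  rewrite -/w !addE !scaleE u0 wu -/a -/b; lra.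
apply: mulmx_tr_eq0; rewrite -/w -/a leNgt; apply/negP => a0.
have d0 : 0 < b + 1 by lra.
(* - a / b minimizes the right-hand side of [key] when b > 0; b + 1 also covers
   the case b = 0. *)
have := key (- a / (b + 1)).
have -> : 2 * (- a / (b + 1)) * a + (- a / (b + 1)) ^+ 2 * b =
   - (a ^+ 2 * (b + 2)) / (b + 1) ^+ 2 by field; rewrite gt_eqF.
have b2 : 0 < b + 2 by lra.
by rewrite leNgt mulNr oppr_lt0 divr_gt0 ?exprn_gt0 ?mulr_gt0 ?exprn_gt0.
Qed.

(** A vector killed by [P + Q] is isotropic for [P] and for [Q], hence killed by
    both; by symmetry of the matrices, an inclusion of kernels reverses into one
    of row spaces. *)
Lemma psd_addsmx (F : realFieldType) n (P Q : 'M[F]_n) :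
  psd P -> psd Q -> ((P + Q)%R :=: P + Q)%MS.
Proof.
move=> hP hQ; have hW := psdD hP hQ.
suff sub (P' Q' : 'M[F]_n) : psd P' -> psd Q' -> (P' <= (P' + Q')%R)%MS.
  apply/eqmxP; rewrite addmx_sub_adds ?submx_refl//= addsmx_sub sub//=.
  by rewrite addrC sub.
move=> {P Q hP hQ hW} hP hQ; have [sW _] := psdD hP hQ.
set W := P' + Q' in sW *.
pose K := (cokermx W)^T.
have KW : K *m W = 0 by rewrite -sW -trmx_mul mulmx_coker trmx0.
rewrite submxE; have [sP pP] := hP; have [_ pQ] := hQ.
apply/eqP; apply: trmx_inj; rewrite trmx_mul trmx0 sP -/K.
apply/row_matrixP => i; rewrite row_mul row0; apply: psd_isotropic => //.
have : (row i K *m W *m (row i K)^T) 0 0 = 0.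
  by rewrite -row_mul KW row0 mul0mx mxE.
rewrite mulmxDr mulmxDl mxE => /eqP; rewrite paddr_eq0 //.
by move=> /andP[/eqP].
Qed.

(** The dimension formula for sums of subspaces reduces the inequality to the
    inclusion of [P :&: G] in [(P + D) :&: G]. *)
Lemma psd_rank_submodular (F : realFieldType) n (P D G : 'M[F]_n) :
  psd P -> psd D -> psd G ->
  (\rank (P + D + G)%R + \rank P <= \rank (P + G)%R + \rank (P + D)%R)%N.
Proof.
move=> hP hD hG; have hPD := psdD hP hD.
rewrite (psd_addsmx hPD hG) (psd_addsmx hP hG).
have := mxrank_sum_cap P G; have := mxrank_sum_cap (P + D)%R G.
have : (\rank (P :&: G) <= \rank ((P + D)%R :&: G))%N.
  apply: mxrankS; apply: capmxS => //.
  by rewrite (psd_addsmx hP hD) addsmxSl.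
lia.
Qed.

(** * A quadratic Lyapunov function for a stable matrix *)

(** The real part of the Hermitian inner product. *)
Definition re_dot (R : rcfType) n (y z : 'rV[R[i]]_n) : R :=
  \sum_i (Re (y 0 i) * Re (z 0 i) + Im (y 0 i) * Im (z 0 i)).

Lemma Re_mul_cross_le (R : rcfType) (y z b : R[i]) (k : R) :
  `|Re b| + `|Im b| <= k ->
  Re y * Re (z * b) + Im y * Im (z * b) <=
  k * ((Re y ^+ 2 + Im y ^+ 2) + (Re z ^+ 2 + Im z ^+ 2)).
Proof.
case: y z b => [y1 y2] [z1 z2] [b1 b2] /=; rewrite -!/(Re _) -!/(Im _) /=.
set S := (X in k * X) => hk.
have S0 : 0 <= S by rewrite !addr_ge0 ?sqr_ge0.
have -> : y1 * (z1 * b1 - z2 * b2) + y2 * (z1 * b2 + z2 * b1) =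
  b1 * (y1 * z1 + y2 * z2) + b2 * (y2 * z1 - y1 * z2) by ring.
have bnd (b u : R) : `|u| <= S -> b * u <= `|b| * S.
  move=> uS; apply: le_trans (ler_norm _) _.
  by rewrite normrM ler_wpM2l.
apply: le_trans (ler_wpM2r S0 hk); rewrite mulrDl.
have sq (u v : R) : 0 <= (u + v) ^+ 2 by exact: sqr_ge0.
apply: lerD; apply: bnd; rewrite ler_norml /S.
  have := sq y1 z1; have := sq y2 z2.
  have := sq y1 (- z1); have := sq y2 (- z2).
  have := sqr_ge0 y1; have := sqr_ge0 y2.
  have := sqr_ge0 z1; have := sqr_ge0 z2.
  by nra.
have := sq y1 z2; have := sq y2 z1.
have := sq y1 (- z2); have := sq y2 (- z1).
have := sqr_ge0 y1; have := sqr_ge0 y2.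
have := sqr_ge0 z1; have := sqr_ge0 z2.
by nra.
Qed.

(** Conjugating a lower triangular [T] by the diagonal matrix of the [e ^ i]
    multiplies the entry [(i, j)] by [e ^ (i - j)]: the diagonal is kept and,
    for small [e], the rest is dominated by the real parts of the diagonal. *)
Lemma trig_dissipative (R : rcfType) n (T : 'M[R[i]]_n) :
  is_trig_mx T -> (forall i, Re (T i i) < 0) ->
  exists2 D : 'M[R[i]]_n, D \in unitmx &
  exists2 c : R, 0 < c &
    forall y : 'rV_n,
      re_dot y (y *m (D *m T *m invmx D)) <= - c * re_dot y y.
Proof.
move=> /is_trig_mxP trigT negT.
pose m : R := \big[Num.min/1]_i (- Re (T i i)).
have m0 : 0 < m by apply: lt_bigmin => // i _; rewrite oppr_gt0.
have mle i : m <= - Re (T i i) by exact: bigmin_le.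
pose k i j : R := `|Re (T i j)| + `|Im (T i j)|.
have k0 i j : 0 <= k i j by rewrite addr_ge0.
pose K : R := \sum_i \sum_j k j i.
have K0 : 0 <= K.
  by apply: sumr_ge0 => i _; apply: sumr_ge0 => j _; exact: k0.
(* The cross terms add up to at most 2 e K times the squared norm, and the
   diagonal contributes at most - m times it: this e loses half of m. *)
pose e : R := m / (4 * (K + m)).
have e0 : 0 < e by rewrite divr_gt0// mulr_gt0//; lra.
have e1 : e <= 1 by rewrite ler_pdivrMr; lra.
have eK : e * K * 2 <= m / 2.
  rewrite /e mulrAC -mulrA mulrAC ler_pdivrMr; last lra.
  nra.
have en0 i : (e ^+ i)%:C%C != 0 :> R[i].
  rewrite -(rmorph0 (real_complex R)) (inj_eq (@complexI R)).
  by rewrite expf_neq0 ?gt_eqF.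
pose d : 'rV[R[i]]_n := \row_i (e ^+ i)%:C%C.
pose d' : 'rV[R[i]]_n := \row_i ((e ^+ i)%:C%C)^-1.
have dd' : diag_mx d *m diag_mx d' = 1%:M.
  rewrite mulmx_diag -diag_const_mx; congr diag_mx; apply/rowP => i.
  by rewrite !mxE mulfV.
have [uD _] := mulmx1_unit dd'.
exists (diag_mx d) => //.
have -> : invmx (diag_mx d) = diag_mx d'.
  by rewrite -[RHS]mul1mx -(mulVmx uD) -mulmxA dd' mulmx1.
exists (m / 2); first lra.
move=> y; pose s i : R := Re (y 0 i) ^+ 2 + Im (y 0 i) ^+ 2.
have s0 i : 0 <= s i by rewrite addr_ge0 ?sqr_ge0.
set B := _ *m _ *m _.
have BE i j : B i j = (e ^+ i)%:C%C * T i j * ((e ^+ j)%:C%C)^-1.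
  by rewrite /B mul_mx_diag mul_diag_mx !mxE.
pose S := \sum_i s i.
have S0 : 0 <= S by exact: sumr_ge0.
have sS i : s i <= S by rewrite /S (bigD1 i)//= lerDl sumr_ge0.
have -> : re_dot y y = S by apply: eq_bigr => i _; rewrite -!expr2.
have term i j :
    Re (y 0 i) * Re (y 0 j * B j i) + Im (y 0 i) * Im (y 0 j * B j i)
    <= (if j == i then - m * s i else 0) + e * k j i * (2 * S).
  have r0 j' : 0 <= e * k j' i * (2 * S).
    by apply: mulr_ge0; [rewrite mulr_ge0 ?(ltW e0)|rewrite mulr_ge0].
  rewrite BE; have [->|nij] := eqVneq j i.
    have -> : (e ^+ i)%:C%C * T i i / (e ^+ i)%:C%C = T i i.
      by rewrite mulrAC divff ?mul1r.
    apply: (@le_trans _ _ (- m * s i)); last by rewrite lerDl.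
    have := mle i; have := s0 i; rewrite /s.
    case: (y 0 i) (T i i) => [y1 y2] [t1 t2] /=.
    rewrite -!/(Re _) -!/(Im _) /=.
    nra.
  rewrite add0r; have [lji|lij] := ltnP j i.
    by rewrite trigT// mulr0 mul0r mulr0 /= !mulr0 addr0.
  have {nij}lij : (i < j)%N by rewrite ltn_neqAle lij andbT eq_sym.
  have -> : (e ^+ j)%:C%C * T j i / (e ^+ i)%:C%C = T j i * (e ^+ (j - i))%:C%C.
    by rewrite -{1}(subnK (ltnW lij)) exprD rmorphM/= [RHS]mulrC mulrAC mulfK.
  apply: le_trans (Re_mul_cross_le _ _ (k := e * k j i) _) _.
    have : e ^+ (j - i) <= e.
      rewrite -[leRHS]expr1 ler_wiXn2l// ?ltW//; lia.
    have : 0 <= e ^+ (j - i) by rewrite exprn_ge0// ltW.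
    move: (e ^+ _) => f f0 fe; rewrite /k.
    case: (T j i) => [t1 t2] /=.
    rewrite !mulr0 subr0 add0r !normrM (ger0_norm f0).
    by rewrite -mulrDl mulrC ler_wpM2r// addr_ge0.
  apply: ler_wpM2l; first by rewrite mulr_ge0// ltW.
  by rewrite -/(s i) -/(s j) mulr2n mulrDl mul1r lerD.
rewrite /re_dot.
under eq_bigr => i _.
  rewrite mxE !raddf_sum/= !mulr_sumr -big_split/=.
  over.
apply: le_trans (ler_sum _ (fun i _ => ler_sum _ (fun j _ => term i j))) _.
under eq_bigr do rewrite big_split/= -big_mkcond big_pred1_eq.
rewrite big_split/= -mulr_sumr.
under [X in _ + X]eq_bigr do rewrite -mulr_suml -mulr_sumr.
rewrite -mulr_suml -mulr_sumr -/K -/S.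
nra.
Qed.

Lemma trigonalizable_complex (R : rcfType) n (A : 'M[R[i]]_n) :
  exists2 P : 'M[R[i]]_n, P \in unitmx & is_trig_mx (P *m A *m invmx P).
Proof.
case: n A => [|n] A.
  by exists 1%:M; rewrite ?unitmx1//; apply/is_trig_mxP; case.
have [//|P /unitarymx_unit uP trigP] := Schur A.
by exists P => //; rewrite -conjumx.
Qed.

Lemma stable_dissipative (R : rcfType) n (A : 'M[R[i]]_n) :
  (forall l, eigenvalue A l -> Re l < 0) ->
  exists2 U : 'M[R[i]]_n, U \in unitmx &
  exists2 c : R, 0 < c &
    forall y : 'rV_n,
      re_dot y (y *m (U *m A *m invmx U)) <= - c * re_dot y y.
Proof.
move=> stA; have [P uP trigT] := trigonalizable_complex A.
set T := P *m A *m invmx P in trigT.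
have negT i : Re (T i i) < 0.
  apply: stA; suff : T i i \in eigenvalue (conjmx P A).
    by apply: eigenvalue_conjmx; rewrite ?stablemx_unit ?row_free_unit.
  rewrite conjumx// -/T -[_ \in _]/(eigenvalue T (T i i)).
  rewrite eigenvalue_root_char char_poly_trig//.
  by rewrite /root horner_prod (bigD1 i)//= !hornerE subrr mul0r.
have [D uD [c c0 hc]] := trig_dissipative trigT negT.
exists (D *m P); first by rewrite unitmx_mul uD.
exists c => // y.
have uDP : D *m P \in unitmx by rewrite unitmx_mul uD.
have -> : invmx (D *m P) = invmx P *m invmx D.
  apply: (can_inj (mulKmx uDP)).
  by rewrite mulmxV// mulmxA mulmxK// mulmxV.
by have := hc y; rewrite /T !mulmxA.
Qed.

Lemma sqr_sum_le (R : realDomainType) (I : finType) (t : I -> R) :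
  (\sum_i t i) ^+ 2 <= \sum_i \sum_j (t i ^+ 2 + t j ^+ 2).
Proof.
rewrite expr2 mulr_suml; apply: ler_sum => i _.
rewrite mulr_sumr; apply: ler_sum => j _.
have := sqr_ge0 (t i - t j); have := sqr_ge0 (t i + t j).
by nra.
Qed.

(** [H] is the squared Hermitian norm of the coordinates of a real vector in the
    basis that makes [A] dissipative.  It is real and symmetric because the
    squared norm of [x V] is the sum of those of [x (Re V)] and [x (Im V)].
    Invertibility of [V] gives the bound on the coordinates. *)
Lemma stable_lyapunov (R : rcfType) n (A : 'M[R]_n) : stable A ->
  exists2 H : 'M[R]_n, psd H &
  (exists2 c : R, 0 < c &
    forall x : 'rV_n,
      (x *m A *m H *m x^T) 0 0 <= - c * (x *m H *m x^T) 0 0) /\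
  (exists2 C : R, 0 <= C &
    forall (x : 'rV_n) j, x 0 j ^+ 2 <= C * (x *m H *m x^T) 0 0).
Proof.
move=> stA; set Ac := map_mx (real_complex R) A in stA.
have [U uU [c c0 dis]] := stable_dissipative stA.
pose V := invmx U; pose V1 := map_mx (@Re R) V; pose V2 := map_mx (@Im R) V.
pose H := V1 *m V1^T + V2 *m V2^T.
pose cx (x : 'rV[R]_n) : 'rV[R[i]]_n := map_mx (real_complex R) x *m V.
have Recx x i : Re (cx x 0 i) = (x *m V1) 0 i.
  rewrite !mxE raddf_sum; apply: eq_bigr => j _; rewrite !mxE.
  by case: (V j i) => v1 v2 /=; rewrite mul0r subr0.
have Imcx x i : Im (cx x 0 i) = (x *m V2) 0 i.
  rewrite !mxE raddf_sum; apply: eq_bigr => j _; rewrite !mxE.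
  by case: (V j i) => v1 v2 /=; rewrite mul0r addr0.
have HE x z : (x *m H *m z^T) 0 0 = re_dot (cx x) (cx z).
  rewrite /re_dot big_split/=.
  rewrite mulmxDr mulmxDl mxE !mulmxA -!(mulmxA _ _ z^T) -!trmx_mul !mulmx_trE.
  by congr (_ + _); apply: eq_bigr => i _; rewrite ?Recx ?Imcx.
have cxA x : cx (x *m A) = cx x *m (U *m Ac *m invmx U).
  by rewrite /cx map_mxM -/Ac -/V !mulmxA mulmxKV.
exists H; first by apply: psdD; exact: psd_mulmxT.
split.
  exists c => // x; rewrite !HE cxA.
  apply: le_trans (dis (cx x)); rewrite le_eqVlt; apply/orP; left; apply/eqP.
  by apply: eq_bigr => i _; rewrite mulrC [Im _ * _]mulrC.
pose g i j : R := Re (U i j) ^+ 2 + Im (U i j) ^+ 2.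
have g0 i j : 0 <= g i j by rewrite addr_ge0 ?sqr_ge0.
pose C j : R := \sum_i \sum_l (g i j + g l j).
have C0 j : 0 <= C j.
  by apply: sumr_ge0 => i _; apply: sumr_ge0 => l _; rewrite addr_ge0.
exists (\sum_j C j); first by apply: sumr_ge0 => j _; exact: C0.
move=> x j; rewrite HE; set S := re_dot _ _.
pose s i : R := Re (cx x 0 i) ^+ 2 + Im (cx x 0 i) ^+ 2.
have s0 i : 0 <= s i by rewrite addr_ge0 ?sqr_ge0.
have SE : S = \sum_i s i by apply: eq_bigr => i _; rewrite -!expr2.
have S0 : 0 <= S by rewrite SE; exact: sumr_ge0.
have sS i : s i <= S by rewrite SE (bigD1 i)//= lerDl sumr_ge0.
have xE : x 0 j = \sum_i Re (cx x 0 i * U i j).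
  rewrite -raddf_sum/=.
  have -> : \sum_i cx x 0 i * U i j = (cx x *m U) 0 j by rewrite mxE.
  by rewrite /cx -mulmxA mulVmx// mulmx1 mxE.
have tS i : Re (cx x 0 i * U i j) ^+ 2 <= g i j * S.
  apply: le_trans (ler_wpM2l (g0 i j) (sS i)); rewrite /g /s.
  case: (cx x 0 i) (U i j) => [y1 y2] [u1 u2] /=.
  rewrite -!/(Re _) -!/(Im _) /=.
  (* Lagrange's identity: the difference of the two sides is this square. *)
  have := sqr_ge0 (y1 * u2 + y2 * u1); nra.
rewrite xE; apply: le_trans (sqr_sum_le _) _.
apply: (@le_trans _ _ (C j * S)).
  rewrite mulr_suml; apply: ler_sum => i _; rewrite mulr_suml.
  by apply: ler_sum => l _; rewrite mulrDl lerD.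
by rewrite ler_wpM2r// (bigD1 j)//= lerDl sumr_ge0.
Qed.

(** * The matrix exponential, entry by entry *)

Lemma cvg_mx_entries (T : topologicalType) m n I (F : set_system I)
    (FF : Filter F) (u : I -> 'M[T]_(m, n)) (L : 'M[T]_(m, n)) :
  (forall i j, u k i j @[k --> F] --> L i j) -> u @ F --> L.
Proof.
move=> uL A [P LP sPA].
have : \forall k \near F,
    forall ij : 'I_m * 'I_n, P ij.1 ij.2 (u k ij.1 ij.2).
  by apply: filter_forall => -[i j]; exact: uL (LP i j).
by apply: filterS => k Pk; apply: sPA => i j; exact: (Pk (i, j)).
Qed.

(** Coefficients of the power series in [t] of the entries of [e^(tA) B]: the
    factor [B] makes the family closed under differentiation of the series,
    which replaces [B] by [A B]. *)
Definition expmx_coef (R : realType) n (A B : 'M[R]_n) i j (k : nat) : R :=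
  (A ^+ k *m B) i j / k`!%:R.

Definition expmx_entry (R : realType) n (A : 'M[R]_n) (t : R) i j : R :=
  limn (pseries (expmx_coef A 1%:M i j) t).

Lemma pseries_diffs_expmx_coef (R : realType) n (A B : 'M[R]_n) i j :
  pseries_diffs (expmx_coef A B i j) = expmx_coef A (A *m B) i j.
Proof.
apply/funext => k; rewrite /pseries_diffs /expmx_coef exprSr -mulmxA factS natrM.
by rewrite invfM mulrCA mulVKf ?pnatr_eq0.
Qed.

Lemma norm_exprmx_le (R : realType) n (A : 'M[R]_n) :
  exists2 K : R, 0 <= K &
  forall B : 'M[R]_n, exists2 b : R, 0 <= b &
  forall k i j, `|(A ^+ k *m B) i j| <= K ^+ k * b.
Proof.
have le_sum (I : finType) (f : I -> R) i :
    (forall i, 0 <= f i) -> f i <= \sum_i f i.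
  by move=> f0; rewrite (bigD1 i)//= lerDl sumr_ge0.
pose N (B : 'M[R]_n) : R := \sum_i \sum_j `|B i j|.
have N0 B : 0 <= N B by apply: sumr_ge0 => i _; exact: sumr_ge0.
have rowN (B : 'M[R]_n) i : \sum_j `|B i j| <= N B.
  by apply: (le_sum _ (fun i => \sum_j `|B i j|)) => i'; exact: sumr_ge0.
exists (N A) => // B; exists (N B) => //.
elim=> [|k IH] i j.
  rewrite expr0 mul1r mul1mx; apply: le_trans (rowN B i).
  exact: (le_sum _ (fun j => `|B i j|)).
rewrite exprS -mulmxA mxE; apply: le_trans (ler_norm_sum _ _ _) _.
rewrite exprS -mulrA.
apply: (@le_trans _ _ (\sum_l `|A i l| * (N A ^+ k * N B))).
  by apply: ler_sum => l _; rewrite normrM ler_wpM2l.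
by rewrite -mulr_suml ler_wpM2r// mulr_ge0// exprn_ge0.
Qed.

Lemma is_cvg_expmx_coef (R : realType) n (A B : 'M[R]_n) i j t :
  cvgn (pseries (expmx_coef A B i j) t).
Proof.
have [K K0 /(_ B)[b b0 hb]] := norm_exprmx_le A.
apply: normed_cvg.
apply: (@series_le_cvg _ _ (fun k => b * exp_coeff (K * `|t|) k)) => [k|k|k|].
- exact: normr_ge0.
- by rewrite mulr_ge0// /exp_coeff divr_ge0// exprn_ge0// mulr_ge0.
- rewrite /exp_coeff/= !normrM normrX normfV (ger0_norm (ler0n _ _)).
  rewrite exprMn mulrAC [leRHS]mulrA ler_wpM2r// ?invr_ge0// mulrA ler_wpM2r//.
  by rewrite mulrC.
- apply: is_cvg_seriesZ; exact: is_cvg_series_exp_coeff.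
Qed.

Lemma expmxE (R : realType) n (A : 'M[R]_n) t i j :
  expmx (t *: A) i j = expmx_entry A t i j.
Proof.
have -> : expmx (t *: A) = \matrix_(i, j) expmx_entry A t i j.
  apply: cvg_lim; first exact: norm_hausdorff.
  apply: cvg_mx_entries => {}i {}j; rewrite mxE.
  rewrite [X in X @ _ --> _](_ : _ = pseries (expmx_coef A 1%:M i j) t).
    exact: is_cvg_expmx_coef.
  apply/funext => k; rewrite /pseries /series /= summxE.
  apply: eq_bigr => l _.
  have -> : (t *: A) ^+ l = t ^+ l *: A ^+ l.
    elim: l => [|l IH]; first by rewrite !expr0 scale1r.
    by rewrite !exprS IH -[LHS]/(_ *m _) -scalemxAl -scalemxAr scalerA.
  by rewrite scalerA mxE /expmx_coef mulmx1; ring.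
by rewrite mxE.
Qed.

Lemma lim_expmx_coef (R : realType) n (A B : 'M[R]_n) t i j :
  limn (pseries (expmx_coef A B i j) t) =
  \sum_l expmx_entry A t i l * B l j.
Proof.
apply: cvg_lim => //.
rewrite [X in X @ _ --> _](_ : _ =
   (fun k => \sum_l (pseries (expmx_coef A 1%:M i l) t k * B l j))).
  apply: cvg_big => [|l _]; first exact: add_continuous.
  apply: cvgM; last exact: cvg_cst.
  exact: is_cvg_expmx_coef.
apply/funext => k; rewrite /pseries /series /=.
under [RHS]eq_bigr do rewrite mulr_suml.
rewrite exchange_big/=; apply: eq_bigr => l _.
rewrite /expmx_coef mulmx1 mxE !mulr_suml; apply: eq_bigr => p _; ring.
Qed.

Lemma is_derive_expmx (R : realType) n (A : 'M[R]_n) t i j :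
  is_derive t (1 : R) (fun t => expmx (t *: A) i j)
    ((expmx (t *: A) *m A) i j).
Proof.
rewrite (_ : (fun t => _) =
    (fun t => limn (pseries (expmx_coef A 1%:M i j) t))); last first.
  by apply/funext => s; rewrite expmxE.
have -> : (expmx (t *: A) *m A) i j =
    limn (pseries (pseries_diffs (expmx_coef A 1%:M i j)) t).
  rewrite pseries_diffs_expmx_coef mulmx1 lim_expmx_coef mxE.
  by apply: eq_bigr => l _; rewrite expmxE.
apply: (@pseries_snd_diffs _ _ (`|t| + 1)).
- exact: is_cvg_expmx_coef.
- rewrite pseries_diffs_expmx_coef; exact: is_cvg_expmx_coef.
- rewrite !pseries_diffs_expmx_coef; exact: is_cvg_expmx_coef.
- by rewrite [ltRHS]ger0_norm ?addr_ge0// ltrDl.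
Qed.

Lemma expmx_tr (R : realType) n (A : 'M[R]_n) t :
  expmx (t *: A^T) = (expmx (t *: A))^T.
Proof.
apply/matrixP => i j; rewrite mxE !expmxE /expmx_entry.
congr (limn (pseries _ t)).
apply/funext => k; rewrite /expmx_coef !mulmx1; congr (_ / _).
have -> : A^T ^+ k = (A ^+ k)^T; last by rewrite mxE.
elim: k => [|k IH]; first by rewrite !expr0 trmx1.
by rewrite exprSr exprS IH -[LHS]/(_ *m _) -trmx_mul.
Qed.

(** * Exponential decay of the matrix exponential *)

Lemma is_derive_quad (R : realType) n (H : 'M[R]_n) (x : R -> 'rV[R]_n)
    (dx : 'rV[R]_n) t :
  (forall j, is_derive t (1 : R) (fun s => x s 0 j) (dx 0 j)) ->
  is_derive t (1 : R) (fun s => (x s *m H *m (x s)^T) 0 0)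
    ((dx *m H *m (x t)^T) 0 0 + (x t *m H *m dx^T) 0 0).
Proof.
move=> hx.
have -> : (fun s => (x s *m H *m (x s)^T) 0 0) =
   \sum_i \sum_j (fun s => x s 0 j * H j i * x s 0 i).
  apply/funext => s; rewrite bilinearE fct_sumE; apply: eq_bigr => i _.
  by rewrite fct_sumE.
rewrite !bilinearE -big_split/=.
apply: is_derive_sum => i; rewrite -big_split/=; apply: is_derive_sum => j.
have h1 : is_derive t (1 : R) (fun s => x s 0 j * H j i) (dx 0 j * H j i).
  rewrite (_ : (fun s => _) = H j i *: (fun s => x s 0 j)); last first.
    by apply/funext => s /=; rewrite mulrC.
  rewrite mulrC; exact: is_deriveZ.
have := is_deriveM h1 (hx i).
by move/is_derive_eq; apply; rewrite /= /GRing.scale/=; ring.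
Qed.

(** Grönwall's inequality: [V t * e^(ct)] is nonincreasing. *)
Lemma gronwall_expR_le (R : realType) (c : R) (V dV : R -> R) :
  (forall t, is_derive t (1 : R) V (dV t)) -> (forall t, dV t <= - c * V t) ->
  forall t, 0 <= t -> V t <= V 0 * expR (- c * t).
Proof.
move=> hV le_dV t t0.
pose g (s : R) := V s * expR (c * s).
have dexp (s : R) :
    is_derive s (1 : R) (fun s => expR (c * s)) (c * expR (c * s)).
  have h : is_derive s (1 : R) (fun s => c * s) c.
    have := is_deriveZ c (is_derive_id s (1 : R)).
    by move/is_derive_eq; apply; rewrite /GRing.scale/= mulr1.
  have := @is_derive1_comp _ expR (fun s => c * s) s _ _
    (is_derive_expR (c * s)) h.
  by move/is_derive_eq; apply; rewrite mulrC.
have dg s :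
    is_derive s (1 : R) g (dV s * expR (c * s) + V s * (c * expR (c * s))).
  have := is_deriveM (hV s) (dexp s).
  by move/is_derive_eq; apply; rewrite /= /GRing.scale/=; ring.
have : g t <= g 0.
  apply: (@ler0_derive1_nincry _ g 0).
  - by move=> s _; have [] := dg s.
  - move=> s _; rewrite derive1E; have [_ ->] := dg s.
    rewrite mulrCA mulrA -mulrDl mulr_le0_ge0 ?expR_ge0//.
    by have := le_dV s; lra.
  - by apply: derivable_within_continuous => s _; have [] := dg s.
  - exact: lexx.
  - exact: t0.
rewrite /g mulr0 expR0 mulr1 mulNr expRN.
by rewrite -ler_pdivlMr ?invr_gt0 ?expR_gt0// invrK.
Qed.

Lemma stable_expmx_decay (R : realType) n (A : 'M[R]_n) : stable A ->
  exists2 c : R, 0 < c & exists2 C : R, 0 <= C &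
  forall t i j, 0 <= t -> expmx (t *: A) i j ^+ 2 <= C * expR (- c * t).
Proof.
move=> stA; have [H [sH pH] [[c c0 hc] [C C0 hC]]] := stable_lyapunov stA.
(* The derivative of x H x^T along x' = x A is 2 x A H x^T. *)
exists (c * 2); first lra.
pose x i t := row i (expmx (t *: A)).
pose V i t : R := (x i t *m H *m (x i t)^T) 0 0.
have V0 i t : 0 <= V i t by exact: pH.
exists (C * \sum_i V i 0); first by rewrite mulr_ge0// sumr_ge0.
move=> t i j t0.
apply: (@le_trans _ _ (C * V i t)); first by have := hC (x i t) j; rewrite mxE.
rewrite -mulrA ler_wpM2l//.
apply: (@le_trans _ _ (V i 0 * expR (- (c * 2) * t))); last first.
  by rewrite ler_wpM2r ?expR_ge0// (bigD1 i)//= lerDl sumr_ge0.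
apply: (@gronwall_expR_le _ _ _
  (fun s => 2 * (x i s *m A *m H *m (x i s)^T) 0 0)) => // s.
  have := @is_derive_quad _ _ H (x i) (x i s *m A) s.
  have -> : (x i s *m H *m (x i s *m A)^T) 0 0 =
      (x i s *m A *m H *m (x i s)^T) 0 0.
    have trE (M : 'M[R]_1) : M 0 0 = M^T 0 0 by rewrite mxE.
    by rewrite [LHS]trE !trmx_mul !trmxK sH !mulmxA.
  rewrite -mulr2n mulr_natl; apply => k.
  rewrite /x -row_mul mxE.
  rewrite (_ : (fun s => _) = fun s => expmx (s *: A) i k).
    exact: is_derive_expmx.
  by apply/funext => r; rewrite mxE.
have := hc (x i s); rewrite -/(V i s); lra.
Qed.

(** * The Gramian as a positive additive map *)

Lemma Rintegral_sum d (T : measurableType d) (R : realType)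
    (mu : {measure set T -> \bar R}) (D : set T) (I : Type) (r : seq I)
    (f : I -> T -> R) :
  measurable D -> (forall i, mu.-integrable D (EFin \o f i)) ->
  \int[mu]_(x in D) (\sum_(i <- r) f i x) =
  \sum_(i <- r) \int[mu]_(x in D) f i x.
Proof.
move=> mD fi; elim: r => [|i r IH].
  by under eq_Rintegral do rewrite big_nil; rewrite big_nil /Rintegral integral0.
under eq_Rintegral do rewrite big_cons.
rewrite big_cons -IH RintegralD//.
rewrite (_ : _ \o _ = (fun x => \sum_(j <- r) (EFin \o f j) x)%E).
  exact: integrable_sum.
by apply/funext => x /=; rewrite sumEFin.
Qed.

Lemma measurable_expmx (R : realType) n (A : 'M[R]_n) i j :
  measurable_fun setT (fun t : R => expmx (t *: A) i j).
Proof.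
apply: continuous_measurable_fun => t.
apply: differentiable_continuous; apply/derivable1_diffP.
by have [] := is_derive_expmx A t i j.
Qed.

Lemma integrable_expmxM (R : realType) n (A : 'M[R]_n) (stA : stable A)
    i k j l :
  (@lebesgue_measure R).-integrable `[0, +oo[
    (EFin \o (fun t => expmx (t *: A) i k * expmx (t *: A) j l)).
Proof.
have [c c0 [C C0 hC]] := stable_expmx_decay stA.
apply: (@le_integrable _ _ _ (@lebesgue_measure R) `[0, +oo[%classic _ _
  (fun t => (C / c)%:E * (EFin \o exponential_pdf c) t)%E).
- exact: measurable_itv.
- apply/measurable_EFinP; apply: measurable_funTS.
  by apply: measurable_funM; exact: measurable_expmx.
- move=> t; rewrite /= in_itv/= andbT => t0.
  rewrite lee_fin exponential_pdfE// ?(ltW c0)// mulrA divfK ?gt_eqF//.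
  rewrite [leRHS]ger0_norm ?mulr_ge0 ?expR_ge0//.
  have := hC t i k t0; have := hC t j l t0.
  move: (expmx _ i k) (expmx _ j l) (C * _) => a b M bM aM.
  have := sqr_ge0 (a - b); have := sqr_ge0 (a + b).
  by rewrite ler_norml; nra.
apply: integrableZl => //.
exact: integrableS (integrable_exponential_pdf c0).
Qed.

Definition gram_integral (R : realType) n (A Q : 'M[R]_n) : 'M[R]_n :=
  \matrix_(i, j) \int[@lebesgue_measure R]_(t in `[0, +oo[)
    (expmx (t *: A) *m Q *m (expmx (t *: A))^T) i j.

Lemma integrable_gram (R : realType) n (A : 'M[R]_n) (stA : stable A) Q i j :
  (@lebesgue_measure R).-integrable `[0, +oo[
    (EFin \o (fun t => (expmx (t *: A) *m Q *m (expmx (t *: A))^T) i j)).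
Proof.
rewrite (_ : _ \o _ = (fun t => \sum_l \sum_k
    (Q k l)%:E * (expmx (t *: A) i k * expmx (t *: A) j l)%:E)%E).
  apply: integrable_sum => // l _; apply: integrable_sum => // k _.
  by apply: integrableZl => //; exact: integrable_expmxM.
apply/funext => t /=; rewrite mxE -sumEFin; apply: eq_bigr => l _.
rewrite !mxE mulr_suml -sumEFin; apply: eq_bigr => k _.
by rewrite -EFinM; congr EFin; ring.
Qed.

Lemma gram_integralD (R : realType) n (A : 'M[R]_n) (stA : stable A) P Q :
  gram_integral A (P + Q) = gram_integral A P + gram_integral A Q.
Proof.
apply/matrixP => i j; rewrite !mxE -RintegralD//; try exact: integrable_gram.
by apply: eq_Rintegral => t _; rewrite mulmxDr mulmxDl mxE.
Qed.

(** By linearity of the integral, the form at [u] is the integral of the form of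
    [Q] at [u e^(tA)]. *)
Lemma psd_gram_integral (R : realType) n (A : 'M[R]_n) (stA : stable A) Q :
  psd Q -> psd (gram_integral A Q).
Proof.
move=> [sQ pQ]; pose G t := expmx (t *: A) *m Q *m (expmx (t *: A))^T; split.
  apply/matrixP => i j; rewrite !mxE; apply: eq_Rintegral => t _.
  rewrite -/(G t); have -> : G t j i = (G t)^T i j by rewrite [RHS]mxE.
  by rewrite /G !trmx_mul trmxK sQ mulmxA.
move=> u.
suff -> : (u *m gram_integral A Q *m u^T) 0 0 =
    \int[@lebesgue_measure R]_(t in `[0, +oo[) (u *m G t *m u^T) 0 0.
  apply: Rintegral_ge0 => t _.
  by have := pQ (u *m expmx (t *: A)); rewrite /G trmx_mul !mulmxA.
rewrite bilinearE.
under eq_Rintegral do rewrite bilinearE.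
have intg i j : (@lebesgue_measure R).-integrable `[0, +oo[
    (EFin \o (fun t => u 0 j * G t j i * u 0 i)).
  rewrite (_ : _ \o _ = (fun t => (u 0 j * u 0 i)%:E *
     (EFin \o (fun t => G t j i)) t)%E).
    by apply: integrableZl => //; exact: integrable_gram.
  by apply/funext => t /=; rewrite -EFinM mulrAC.
rewrite Rintegral_sum//; last first.
  move=> i.
  rewrite (_ : _ \o _ = (fun t => \sum_j
      (EFin \o (fun t => (u 0 j * G t j i * u 0 i)%R)) t)%E).
    exact: integrable_sum.
  by apply/funext => t /=; rewrite sumEFin.
apply: eq_bigr => i _; rewrite Rintegral_sum//; apply: eq_bigr => j _.
rewrite mxE mulrAC -RintegralZl//; last exact: integrable_gram.
by apply: eq_Rintegral => t _; rewrite mulrAC.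
Qed.

(** * Submodularity of the rank *)

Lemma input_mx_mulT (R : realType) n p M (B0 : 'M[R]_(n, p))
    (b : 'I_M -> 'cV[R]_n) S :
  input_mx B0 b S *m (input_mx B0 b S)^T =
  B0 *m B0^T + \sum_(s in S) b s *m (b s)^T.
Proof.
rewrite /input_mx tr_row_mx mul_row_col; congr (_ + _).
apply/matrixP => i j; rewrite mxE summxE.
rewrite [RHS]big_enum_val; apply: eq_bigr => k _.
by rewrite !mxE big_ord_recl big_ord0 addr0 !mxE !ord1.
Qed.

Theorem theorem4 (R : realType) (n p M : nat) (A : 'M[R]_n)
    (B0 : 'M[R]_(n, p)) (b : 'I_M -> 'cV[R]_n) (hA : stable A) :
  submodular (fun S : {set 'I_M} => (\rank (gramian A B0 b S))%:R : R).
Proof.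
pose q s := b s *m (b s)^T.
pose Q (S : {set 'I_M}) := B0 *m B0^T + \sum_(s in S) q s.
have gramE S : gramian A B0 b S = gram_integral A (Q S).
  apply/matrixP => i j; rewrite !mxE; apply: eq_Rintegral => t _.
  by rewrite /gramian_integrand expmx_tr -(mulmxA (expmx _)) input_mx_mulT.
have psdq (S : {set 'I_M}) : psd (\sum_(s in S) q s).
  apply: big_ind => [|P P'|s _]; [|exact: psdD|exact: psd_mulmxT].
  by split=> [|u]; rewrite ?trmx0// mulmx0 mul0mx mxE.
move=> X Y a XY aY; rewrite !gramE.
have QU (S : {set 'I_M}) : a \notin S -> Q (a |: S) = Q S + q a.
  by move=> aS; rewrite /Q big_setU1//= addrCA addrC.
have QY : Q Y = Q X + \sum_(s in Y :\: X) q s.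
  by rewrite /Q (big_setID X) /= (finset.setIidPr XY) addrA.
have aX : a \notin X by apply: contraNN aY; exact: (fintype.subsetP XY).
rewrite !QU// QY (gram_integralD hA (_ + _) (q a)) !(gram_integralD hA (Q X)).
have psdX : psd (Q X) by apply: psdD; [exact: psd_mulmxT|exact: psdq].
have := psd_rank_submodular (psd_gram_integral hA psdX)
  (psd_gram_integral hA (psdq (Y :\: X)))
  (psd_gram_integral hA (psd_mulmxT (b a))).
rewrite -(ler_nat R) !natrD; lra.
Qed.
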